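(* Suppose that $W_{\boldsymbol\lambda}\in \boldsymbol B(\ell^2)$ is a CPD unilateral weighted shift. Let $\mathcal E$ be the linear span of $\{e_n\colon n\in\mathbb Z_+\}$, let $\|h\|_2=\sqrt{\langle \mathscr B_2(W_{\boldsymbol\lambda})h,h\rangle}$ for $h\in\mathcal E$ (a seminorm on $\mathcal E$), and let $\mathcal M=\bigvee_{j=1}^{\infty} \{e_j\}$. Then the following conditions are equivalent: (i) $W_{\boldsymbol\lambda}|_{\mathcal M}$ is not a $2$-isometry, (ii) $W_{\boldsymbol\lambda}$ is of type III, (iii) $W_{\boldsymbol\lambda} \neq W_{a,b}$ for all $a \in (0,\infty)$ and $b\in [1,\infty)$ such that $1 - 2 a + a b \geqslant 0$, (iv) $\|\cdot\|_2$ is a norm. Moreover, if $W_{\boldsymbol\lambda} = W_{a,b}$ for some $a \in (0,\infty)$ and $b\in [1,\infty)$ satisfying $1-2a+ab\geqslant0$, then $W_{\boldsymbol\lambda}$ is of type I if and only if $1-2a+ab=0$.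
   Context: $\mathbb Z_+=\{0,1,2,\dots\}$, $\mathbb R_+=[0,\infty)$; $\boldsymbol B(\mathcal H)$ denotes bounded linear operators on a complex Hilbert space $\mathcal H$; $\{e_n\}_{n=0}^\infty$ is the standard orthonormal basis of $\ell^2=\ell^2(\mathbb Z_+)$; $\bigvee$ denotes closed linear span. Unilateral weighted shift: for a bounded sequence $\boldsymbol\lambda=\{\lambda_n\}_{n=0}^\infty\subseteq(0,\infty)$, $W_{\boldsymbol\lambda}\in\boldsymbol B(\ell^2)$ is the operator with $W_{\boldsymbol\lambda}e_n=\lambda_n e_{n+1}$, $n\in\mathbb Z_+$. Put $\hat\lambda_0=1$ and $\hat\lambda_n=\lambda_0^2\cdots\lambda_{n-1}^2$ for $n\geqslant1$. CPD: $T\in\boldsymbol B(\mathcal H)$ is conditionally positive definite (CPD) if for every $h\in\mathcal H$ the sequence $\gamma_n=\|T^nh\|^2$ satisfies $\sum_{i,j=0}^k\gamma_{i+j}\alpha_i\bar\alpha_j\geqslant0$ for all finite complex sequences $\alpha_0,\dots,\alpha_k$ with $\sum_{j=0}^k\alpha_j=0$. Scalar representing triplet: let $Q_0=Q_1=0$ and $Q_n(x)=\sum_{j=0}^{n-2}(n-j-1)x^j$ for $n\geqslant2$. It is known that $W_{\boldsymbol\lambda}$ is CPD if and only if there are $\mathfrak b\in\mathbb R$, $\mathfrak c\in\mathbb R_+$ and a compactly supported finite positive Borel measure $\nu$ on $\mathbb R_+$ with $\nu(\{1\})=0$ such that $\hat\lambda_n=1+\mathfrak bn+\mathfrak cn^2+\int_{\mathbb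 R_+}Q_n\,\mathrm d\nu$ for all $n\in\mathbb Z_+$; the triplet $(\mathfrak b,\mathfrak c,\nu)$ is then unique and is called the scalar representing triplet of $W_{\boldsymbol\lambda}$. Types: a CPD unilateral weighted shift with scalar representing triplet $(\mathfrak b,\mathfrak c,\nu)$ is of type I if $\nu=0$ and $\mathfrak c=0$; of type II if $\operatorname{supp}\nu=\{0\}$ and $\mathfrak c=0$; of type III if $\operatorname{supp}\nu\nsubseteq\{0\}$ or $\mathfrak c\neq0$. $\mathscr B_2(T)=I-2T^*T+T^{*2}T^2$; $T$ is a $2$-isometry if $\mathscr B_2(T)=0$. It is known that $\mathscr B_2(T)\geqslant0$ for every CPD operator $T$. For $a\in(0,\infty)$ and $b\in[1,\infty)$, $W_{a,b}\in\boldsymbol B(\ell^2)$ is the unilateral weighted shift with weights $\lambda_0=\sqrt a$ and $\lambda_n=\sqrt{\frac{1+n(b-1)}{1+(n-1)(b-1)}}$ for $n\geqslant1$. *)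

(* Defs.v *)
From HB Require Import structures.
From mathcomp Require Import all_boot all_order all_algebra.
From mathcomp Require Import sesquilinear complex ring.
From mathcomp Require Import all_classical all_reals all_analysis.

Set Implicit Arguments.
Unset Strict Implicit.
Unset Printing Implicit Defensive.

Import Order.TTheory GRing.Theory Num.Theory.
Import numFieldNormedType.Exports.
Import Normc.

Local Open Scope classical_set_scope.
Local Open Scope ring_scope.

(* Norms and inner products take their values in R[i], as for any normed
   module over R[i]; the order of R[i] makes [0 <= z] include that z is real.
   Inner products are linear in the first argument. *)
HB.mixin Record CompleteNormedModule_isHilbert (R : realType) H
    & CompleteNormedModule R[i] H := {
  inner : {dot H for Num.conj};
  inner_normE : forall x : H, inner x x = `|x| ^+ 2
}.

#[short(type="hilbertType")]
HB.structure Definition Hilbert (R : realType) :=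
  {H of CompleteNormedModule R[i] H & CompleteNormedModule_isHilbert R H}.

Record bounded_op (R : realType) (H : hilbertType R) := BoundedOp {
  op_fun :> {linear H -> H};
  op_continuous : continuous op_fun
}.

Section OperatorTheory.
Variables (R : realType) (H : hilbertType R).
Implicit Types T : bounded_op H.

(* T^* y is the unique z given by the Riesz representation theorem. *)
Definition adjoint T (y : H) : H :=
  xget 0 [set z | forall x, inner (T x) y = inner x z].

Definition B2 T (h : H) : H :=
  h - adjoint T (T h) *+ 2 + adjoint T (adjoint T (T (T h))).

Definition two_isometry T := forall h, B2 T h = 0.

Definition CPD T := forall (h : H) (k : nat) (alpha : 'I_k.+1 -> R[i]),
  \sum_(j < k.+1) alpha j = 0 ->
  0 <= \sum_(i < k.+1) \sum_(j < k.+1)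
         `|iter (i + j) T h| ^+ 2 * alpha i * (alpha j)^*.

Definition B2_seminorm T (h : H) : R[i] := sqrtC (inner (B2 T h) h).

Definition is_norm_on (E : set H) (N : H -> R[i]) :=
  [/\ forall x, E x -> 0 <= N x,
      forall x y, E x -> E y -> N (x + y) <= N x + N y,
      forall (a : R[i]) x, E x -> N (a *: x) = `|a| * N x
    & forall x, E x -> N x = 0 -> x = 0].

Definition lspan (A : set H) : set H :=
  [set x | exists s : seq (R[i] * H), {in s, forall p, A p.2} /\
     x = \sum_(p <- s) p.1 *: p.2].

End OperatorTheory.

Record csubspace (R : realType) (H : hilbertType R) := CSubspace {
  cs_set :> set H;
  cs_closed : closed cs_set;
  cs_submod : cs_set 0 /\
    forall (a : R[i]) x y, cs_set x -> cs_set y -> cs_set (a *: x + y)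
}.

Section SubHilbert.
Variables (R : realType) (H : hilbertType R) (M : csubspace H).

Definition cs_mem : {pred H} := fun x => x \in cs_set M.

Fact cs_mem_submod : submod_closed cs_mem.
Proof.
have [M0 MD] := cs_submod M; split=> [|a x y Mx My]; first exact/mem_set.
by apply/mem_set; apply: MD; apply/set_mem.
Qed.

HB.instance Definition _ := GRing.isSubmodClosed.Build _ _ cs_mem cs_mem_submod.

Record sub_hilbert := SubHilbert { sub_val : H; _ : sub_val \in cs_mem }.

HB.instance Definition _ := [isSub for sub_val].
HB.instance Definition _ := [Choice of sub_hilbert by <:].
HB.instance Definition _ := [SubChoice_isSubLmodule of sub_hilbert by <:].

Let snorm (x : sub_hilbert) : R[i] := `|val x|.

Fact snormD x y : snorm (x + y) <= snorm x + snorm y.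
Proof. by rewrite /snorm raddfD ler_normD. Qed.

Fact snormZ (a : R[i]) x : snorm (a *: x) = `|a| * snorm x.
Proof. by rewrite /snorm linearZ normrZ. Qed.

Fact snorm_eq0 x : snorm x = 0 -> x = 0.
Proof. by move/eqP; rewrite normr_eq0 => /eqP x0; apply: val_inj; rewrite x0 raddf0. Qed.

HB.instance Definition _ :=
  Lmodule_isNormed.Build R[i] sub_hilbert snormD snormZ snorm_eq0.

Lemma sub_normE (x : sub_hilbert) : `|x| = `|val x|.
Proof. by []. Qed.

Fact sub_complete (F : set_system sub_hilbert) :
  ProperFilter F -> cauchy F -> cvg F.
Proof.
move=> FF /cauchy_ballP F_cauchy.
have FvF : ProperFilter (val @ F : set_system H) by exact: fmap_proper_filter.
have Fval : cauchy (val @ F : set_system H).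
  apply/cauchy_ballP => e e0.
  have [[A B] /= [FA FB] AB] := F_cauchy _ e0.
  exists (val @` A, val @` B) => /=.
    by split; rewrite /nbhs/=; [apply: filterS FA|apply: filterS FB] => x Ax;
      exists x.
  move=> [_ _] /= [[x Ax <-] [y By <-]].
  have := AB (x, y) (conj Ax By); rewrite -!ball_normE /=.
  by rewrite sub_normE raddfB.
have /cauchy_cvg/cvg_ex[l Fl] := Fval.
have Ml : cs_set M l.
  apply: (@closed_cvg _ _ F FF (fun x : sub_hilbert => val x) (cs_set M) (@cs_closed _ _ M) _ l Fl).
  by apply: nearW => x; apply/set_mem; exact: (valP x).
apply: (@cvgP _ F (SubHilbert (mem_set Ml) : sub_hilbert)).
apply/fcvgrPdist_lt => e e0.
have /cvgrPdist_lt/(_ _ e0) := Fl.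
by apply: filterS => x; rewrite sub_normE raddfB.
Qed.

HB.instance Definition _ := Uniform_isComplete.Build sub_hilbert sub_complete.

Definition sub_inner (x y : sub_hilbert) : R[i] := inner (val x) (val y).

Fact sub_inner_bilinear :
  bilinear_for ( *%R : R[i] -> R[i] -> R[i]) (Num.conj \; *%R) sub_inner.
Proof.
split=> [u|u] a x y; rewrite /sub_inner linearP.
  by rewrite linearDl linearZl_LR.
by [].
Qed.

HB.instance Definition _ := bilinear_isBilinear.Build R[i] sub_hilbert
  sub_hilbert R[i] *%R (Num.conj \; *%R) sub_inner sub_inner_bilinear.

Fact sub_inner_herm x y :
  sub_inner x y = (-1) ^+ false * Num.conj (sub_inner y x).
Proof. exact: hermitian_subproof. Qed.

HB.instance Definition _ := isHermitianSesquilinear.Build R[i] sub_hilbert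
  false Num.conj sub_inner sub_inner_herm.

Fact sub_inner_gt0 x : x != 0 -> 0 < sub_inner x x.
Proof.
move=> x0; apply: neq0_dnorm_gt0; apply: contra x0 => /eqP x0.
by apply/eqP/val_inj; rewrite x0 raddf0.
Qed.

HB.instance Definition _ :=
  isDotProduct.Build R[i] sub_hilbert sub_inner sub_inner_gt0.

Fact sub_inner_normE (x : sub_hilbert) : sub_inner x x = `|x| ^+ 2.
Proof. exact: inner_normE. Qed.

HB.instance Definition _ := CompleteNormedModule_isHilbert.Build R sub_hilbert
  sub_inner_normE.

End SubHilbert.

Section Restriction.
Variables (R : realType) (H : hilbertType R) (M : csubspace H).
Variables (T : bounded_op H) (TM : forall x, cs_set M x -> cs_set M (T x)).

Definition restr_fun (x : sub_hilbert M) : sub_hilbert M :=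
  SubHilbert (mem_set (TM (set_mem (valP x)))).

Fact restr_fun_linear : linear restr_fun.
Proof. by move=> a x y; apply: val_inj; rewrite /= !linearP. Qed.

HB.instance Definition _ := GRing.isLinear.Build R[i] (sub_hilbert M)
  (sub_hilbert M) *:%R restr_fun restr_fun_linear.

Fact restr_fun_continuous : continuous restr_fun.
Proof.
move=> x; apply/(@cvgrPdist_lt _ (sub_hilbert M) _ (nbhs x)) => e e0.
have /cvgrPdist_lt/(_ _ e0)/nbhs_normP[d /= d0 dT] := @op_continuous _ _ T (val x).
apply/(@nbhs_normP _ (sub_hilbert M)); exists d => //= y /=.
rewrite !sub_normE !raddfB /= => xy; exact: dT.
Qed.

(* T|_M as an operator on the Hilbert space M: its adjoint is taken in M. *)
Definition restriction : bounded_op (sub_hilbert M) :=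
  @BoundedOp R (sub_hilbert M) restr_fun restr_fun_continuous.

End Restriction.

Section ClosedSpan.
Variables (R : realType) (H : hilbertType R) (A : set H).

Lemma lspan0 : lspan A 0.
Proof. by exists [::]; split=> //; rewrite big_nil. Qed.

Lemma lspanP (a : R[i]) x y : lspan A x -> lspan A y -> lspan A (a *: x + y).
Proof.
move=> [s [sA ->]] [t [tA ->]].
exists ([seq (a * p.1, p.2) | p <- s] ++ t); split.
  move=> p; rewrite mem_cat => /orP[/mapP[q qs ->]|]; last exact: tA.
  exact: (sA _ qs).
rewrite big_cat big_map /= scaler_sumr; congr (_ + _).
by apply: eq_bigr => p _; rewrite scalerA.
Qed.

Lemma sub_lspan x : A x -> lspan A x.
Proof.
move=> Ax; exists [:: (1, x)]; split; last by rewrite big_seq1 scale1r.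
by move=> p; rewrite inE => /eqP ->.
Qed.

Lemma closure_lspanP (a : R[i]) x y : closure (lspan A) x ->
  closure (lspan A) y -> closure (lspan A) (a *: x + y).
Proof.
move=> Ax Ay B.
have : (fun z : H * H => a *: z.1 + z.2) @ (nbhs (x, y)) --> a *: x + y.
  by apply: cvgD; [apply: cvgZr; exact: cvg_fst|exact: cvg_snd].
move=> /[apply] -[[U V]] /= [Ux Vy] UVB.
have [u [Au Uu]] := Ax _ Ux; have [v [Av Vv]] := Ay _ Vy.
exists (a *: u + v); split; first exact: lspanP.
exact: (UVB (u, v)).
Qed.

Definition closed_span : csubspace H := @CSubspace R H (closure (lspan A))
  (@closed_closure _ (lspan A))
  (conj (@subset_closure _ (lspan A) _ lspan0) closure_lspanP).

End ClosedSpan.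

Section DotNorm.
Variables (C : numClosedFieldType) (U : lmodType C) (f : {dot U for Num.conj}).

Lemma dot_CauchySchwarz u v : `|f u v| ^+ 2 <= f u u * f v v.
Proof.
have [->|v0] := eqVneq v 0; first by rewrite !linear0r normr0 expr0n /=.
have vv0 : 0 < f v v by rewrite dnorm_gt0.
pose w := f v v *: u - f u v *: v.
have vvC : `|f v v| = f v v by rewrite ger0_norm// ltW.
have Ed : f (f v v *: u) (f u v *: v) = f v v * `|f u v| ^+ 2.
  by rewrite linearZl_LR linearZr_LR /= normCK [(_)^* * _]mulrC.
have EdC : (f v v * `|f u v| ^+ 2)^* = f v v * `|f u v| ^+ 2.
  by apply/CrealP; rewrite ger0_real// mulr_ge0 ?exprn_ge0// ltW.
have := dnorm_ge0 f w.
rewrite /w dnormB !dnormZ Ed EdC vvC.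
set c := f v v in vv0 *; set n := `|f u v| ^+ 2; set d := f u u.
have -> : c ^+ 2 * d + n * c - (c * n + c * n) = c * (d * c - n).
  by rewrite (mulrC n) opprD addrA addrK expr2 -mulrA -mulrBr (mulrC c d).
by rewrite pmulr_rge0// subr_ge0.
Qed.

Lemma dot_normD u v :
  sqrtC (f (u + v) (u + v)) <= sqrtC (f u u) + sqrtC (f v v).
Proof.
rewrite -(@ler_pXn2r _ 2) ?nnegrE ?sqrtC_ge0 ?dnorm_ge0//; last first.
  by rewrite addr_ge0 ?sqrtC_ge0 ?dnorm_ge0.
rewrite sqrtCK sqrrD !sqrtCK dnormD/= addrAC lerD2r lerD2l.
have real_le : f u v + (f u v)^* <= `|f u v| *+ 2.
  apply: (le_trans (real_ler_norm _)).
    by apply/CrealP; rewrite rmorphD /= conjCK addrC.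
  by rewrite (le_trans (ler_normD _ _))// norm_conjC mulr2n.
apply: (le_trans real_le); rewrite lerMn2r/=.
rewrite -(@ler_pXn2r _ 2) ?nnegrE ?mulr_ge0 ?sqrtC_ge0 ?dnorm_ge0//.
by rewrite exprMn !sqrtCK dot_CauchySchwarz.
Qed.

Lemma dot_normZ (a : C) u :
  sqrtC (f (a *: u) (a *: u)) = `|a| * sqrtC (f u u).
Proof.
rewrite dnormZ rootCMl ?exprn_ge0//.
by rewrite sqrCK.
Qed.

Lemma dot_norm_eq0 u : sqrtC (f u u) = 0 -> u = 0.
Proof. by move/eqP; rewrite sqrt_dnorm_eq0 => /eqP. Qed.

End DotNorm.

Local Notation Re := complex.Re.
Local Notation Im := complex.Im.

Section ComplexSeries.
Variable R : realType.

Lemma Re_le_normc (z : R[i]) : `|Re z| <= normc z.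
Proof. by rewrite -lecR; exact: normc_ge_Re. Qed.

Lemma normc_sqr (z : R[i]) : normc z ^+ 2 = Re z ^+ 2 + Im z ^+ 2.
Proof. by case: z => a b /=; rewrite sqr_sqrtr// addr_ge0 ?sqr_ge0. Qed.

Lemma Im_le_normc (z : R[i]) : `|Im z| <= normc z.
Proof.
rewrite -(@ler_pXn2r _ 2) ?nnegrE//; last by case: z => a b; exact: sqrtr_ge0.
by rewrite normc_sqr real_normK ?num_real// lerDr sqr_ge0.
Qed.

Lemma normc_ge0 (z : R[i]) : 0 <= normc z.
Proof. by case: z => a b; exact: sqrtr_ge0. Qed.

Lemma normc_le_ReIm (z : R[i]) : normc z <= `|Re z| + `|Im z|.
Proof.
rewrite -(@ler_pXn2r _ 2) ?nnegrE ?normc_ge0 ?addr_ge0//.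
rewrite normc_sqr sqrrD !real_normK ?num_real//.
by rewrite addrAC lerDl mulrn_wge0// mulr_ge0.
Qed.

Lemma normCE (z : R[i]) : `|z| = (normc z)%:C%C.
Proof. by []. Qed.

Lemma cvg_complex (T : Type) (F : set_system T) (FF : Filter F)
  (u : T -> R[i]) (l : R[i]) :
  (fun n => Re (u n)) @ F --> Re l -> (fun n => Im (u n)) @ F --> Im l ->
  (u : T -> R[i]^o) @ F --> (l : R[i]^o).
Proof.
move=> /cvgrPdist_lt ul /cvgrPdist_lt vl.
apply/(@cvgrPdist_lt _ R[i]^o) => e e0.
have e0R : 0 < Re e by move: e0; rewrite ltcE => /andP[].
have Ee : e = (Re e)%:C%C by rewrite RRe_real// gtr0_real.
have e20 : 0 < Re e / 2 by rewrite divr_gt0.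
move: (ul _ e20) (vl _ e20); apply: filterS2 => t ut vt.
rewrite normCE Ee ltcR (le_lt_trans (normc_le_ReIm _))//.
rewrite [ltRHS](splitr (Re e)); apply: ltrD.
  by move: ut; case: (l) (u t) => [? ?] [? ?].
by move: vt; case: (l) (u t) => [? ?] [? ?].
Qed.

Lemma Re_series (u : nat -> R[i]) n :
  Re (series u n) = series (fun n => Re (u n)) n.
Proof.
by rewrite /series /=; elim/big_rec2: _ => // i a b _ <-; case: (u i) b => [? ?] [? ?].
Qed.

Lemma Im_series (u : nat -> R[i]) n :
  Im (series u n) = series (fun n => Im (u n)) n.
Proof.
by rewrite /series /=; elim/big_rec2: _ => // i a b _ <-; case: (u i) b => [? ?] [? ?].
Qed.

Lemma normc_is_cvg_series (u : nat -> R[i]) :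
  cvgn (series (fun n => normc (u n))) -> cvgn (series u : nat -> R[i]^o).
Proof.
move=> cu.
have cRe : cvgn (series (fun n => Re (u n))).
  apply: normed_cvg; apply: series_le_cvg cu => n //=; first exact: normc_ge0.
  exact: Re_le_normc.
have cIm : cvgn (series (fun n => Im (u n))).
  apply: normed_cvg; apply: series_le_cvg cu => n //=; first exact: normc_ge0.
  exact: Im_le_normc.
apply: (@cvgP R[i]^o _ ((limn (series (fun n => Re (u n))) +i*
                   limn (series (fun n => Im (u n))))%C : R[i]^o)).
apply: cvg_complex => /=.
  by under eq_fun do rewrite Re_series.
by under eq_fun do rewrite Im_series.
Qed.

Lemma cvg_real_complex (u : nat -> R) (l : R) : u @ \oo --> l ->
  (fun n => (u n)%:C%C : R[i]^o) @ \oo --> (l%:C%C : R[i]^o).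
Proof. by move=> ul; apply: cvg_complex => //=; exact: cvg_cst. Qed.

Lemma conj_continuous : continuous (Num.conj : R[i]^o -> R[i]^o).
Proof.
move=> z; apply/(@cvgrPdist_lt _ R[i]^o _ (nbhs z)) => e e0.
apply/(@nbhs_normP _ R[i]^o); exists e => //= y /=.
by rewrite -rmorphB /= norm_conjC.
Qed.

End ComplexSeries.

Section Ell2.
Variable R : realType.

Lemma sqrD_le (p q : R) : (p + q) ^+ 2 <= 2 * p ^+ 2 + 2 * q ^+ 2.
Proof.
rewrite -subr_ge0 (_ : _ - _ = (p - q) ^+ 2) ?sqr_ge0//; ring.
Qed.

Definition square_summable : {pred nat -> R[i]} :=
  fun x => `[< cvgn (series (fun n => normc (x n) ^+ 2)) >].

Fact square_summable_submod : submod_closed square_summable.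
Proof.
split=> [|a x y /asboolP cx /asboolP cy]; apply/asboolP.
  rewrite (_ : series _ = cst 0); first exact: is_cvg_cst.
  apply/funext => n; rewrite /series /= big1// => i _.
  by rewrite expr0n /= addr0 sqrtr0 expr0n.
apply: (@series_le_cvg _ _ (fun n =>
  (2 * normc a ^+ 2) * normc (x n) ^+ 2 + 2 * normc (y n) ^+ 2)) => [n|n|n|].
- exact: sqr_ge0.
- by do ?[exact: sqr_ge0 | exact: ler0n | apply: addr_ge0 | apply: mulr_ge0].
- apply: (@le_trans _ _ ((normc a * normc (x n) + normc (y n)) ^+ 2)).
    rewrite ler_pXn2r ?nnegrE//; last 2 first.
    - exact: normc_ge0.
    - by do ?[exact: normc_ge0 | apply: addr_ge0 | apply: mulr_ge0].
    by rewrite -normcM; exact: le_normcD.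
  by rewrite -mulrA -exprMn; exact: sqrD_le.
apply: is_cvg_seriesD; exact: is_cvg_seriesZ.
Qed.

HB.instance Definition _ := GRing.isSubmodClosed.Build R[i] (nat -> R[i])
  square_summable square_summable_submod.

Record ell2 := Ell2 { ell2_val :> nat -> R[i]; _ : ell2_val \in square_summable }.

HB.instance Definition _ := [isSub for ell2_val].
HB.instance Definition _ := [Choice of ell2 by <:].
HB.instance Definition _ := [SubChoice_isSubLmodule of ell2 by <:].

Implicit Types x y : ell2.

Lemma ell2P x : cvgn (series (fun n => normc (x n) ^+ 2)).
Proof. exact/asboolP/(valP x). Qed.

Lemma ell2D x y n : (x + y) n = x n + y n.
Proof. by rewrite -[LHS]/(val (x + y) n) raddfD. Qed.

Lemma ell2B x y n : (x - y) n = x n - y n.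
Proof. by rewrite -[LHS]/(val (x - y) n) raddfB. Qed.

Lemma ell2Z (a : R[i]) x n : (a *: x) n = a * x n.
Proof. by []. Qed.

Definition ell2_inner x y : R[i] :=
  limn (series (fun n => x n * Num.conj (y n)) : nat -> R[i]^o).

Lemma is_cvg_ell2_inner x y :
  cvgn (series (fun n => x n * Num.conj (y n)) : nat -> R[i]^o).
Proof.
apply: normc_is_cvg_series.
apply: (@series_le_cvg _ _ (fun n => normc (x n) ^+ 2 + normc (y n) ^+ 2)) =>
  [n|n|n|].
- exact: normc_ge0.
- by rewrite addr_ge0 ?sqr_ge0.
- rewrite normcM (_ : normc (_^*) = normc (y n)); last first.
    by apply: complexI; rewrite -!normCE norm_conjC.
  have p0 := normc_ge0 (x n); have q0 := normc_ge0 (y n).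
  move: p0 q0; set p := normc _; set q := normc _ => p0 q0.
  have [pq|qp] := leP p q.
    by rewrite (@le_trans _ _ (q ^+ 2))// ?expr2 ?ler_pM// lerDr sqr_ge0.
  by rewrite (@le_trans _ _ (p ^+ 2))// ?expr2 ?ler_pM// ?(ltW qp)// lerDl sqr_ge0.
by apply: is_cvg_seriesD; exact: ell2P.
Qed.

Lemma ell2_inner_cvg x y :
  (series (fun n => x n * Num.conj (y n)) : nat -> R[i]^o) @ \oo -->
  (ell2_inner x y : R[i]^o).
Proof. exact: is_cvg_ell2_inner. Qed.

Lemma cvg_ell2_inner x y (l : R[i]) :
  (series (fun n => x n * Num.conj (y n)) : nat -> R[i]^o) @ \oo --> (l : R[i]^o) ->
  ell2_inner x y = l.
Proof. by move=> /(@cvg_lim _ (@norm_hausdorff _ R[i]^o)). Qed.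

Fact ell2_inner_herm x y :
  ell2_inner x y = (-1) ^+ false * Num.conj (ell2_inner y x).
Proof.
rewrite expr0 mul1r; apply: cvg_ell2_inner.
rewrite (_ : series _ = Num.conj \o series (fun n => y n * Num.conj (x n))).
  apply: (@cvg_comp _ _ _ _ (Num.conj : R[i]^o -> R[i]^o)).
    exact: ell2_inner_cvg.
  exact: conj_continuous.
apply/funext => n; rewrite /series /= rmorph_sum; apply: eq_bigr => i _.
by rewrite rmorphM /= conjCK mulrC.
Qed.

Fact ell2_inner_linearl y : GRing.linear_for *%R (ell2_inner ^~ y).
Proof.
move=> a u v; apply: cvg_ell2_inner.
rewrite (_ : series _ = fun n => a * (series (fun n => u n * Num.conj (y n)) n) +
  series (fun n => v n * Num.conj (y n)) n).
  apply: (@cvgD _ R[i]^o); last exact: ell2_inner_cvg.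
  by apply: (@cvgMr R[i]); exact: ell2_inner_cvg.
apply/funext => n; rewrite /series /= mulr_sumr -big_split; apply: eq_bigr => i _ /=.
by transitivity ((a * u i + v i) * Num.conj (y i)); last rewrite mulrDl mulrA.
Qed.

Fact ell2_inner_bilinear :
  bilinear_for ( *%R : R[i] -> R[i] -> R[i]) (Num.conj \; *%R) ell2_inner.
Proof.
split=> y; first exact: ell2_inner_linearl.
move=> a u v; rewrite ell2_inner_herm expr0 mul1r ell2_inner_linearl.
by rewrite rmorphD rmorphM/= [in RHS]ell2_inner_herm [ell2_inner y v]ell2_inner_herm !expr0 !mul1r.
Qed.

HB.instance Definition _ := bilinear_isBilinear.Build R[i] ell2 ell2 R[i]
  *%R (Num.conj \; *%R) ell2_inner ell2_inner_bilinear.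

HB.instance Definition _ := isHermitianSesquilinear.Build R[i] ell2
  false Num.conj ell2_inner ell2_inner_herm.

Definition sqnorm x : R := limn (series (fun n => normc (x n) ^+ 2)).

Lemma ell2_innerxx x : ell2_inner x x = (sqnorm x)%:C%C.
Proof.
apply: cvg_ell2_inner.
rewrite (_ : series _ = fun n => (series (fun n => normc (x n) ^+ 2) n)%:C%C).
  apply: cvg_real_complex; exact: ell2P.
apply/funext => n; rewrite /series /= rmorph_sum; apply: eq_bigr => i _.
by rewrite rmorphXn /= -normCE normCK.
Qed.

Lemma partial_sqnorm x n : \sum_(0 <= i < n) normc (x i) ^+ 2 <= sqnorm x.
Proof.
apply: (@nondecreasing_cvgn_le _ (series (fun n => normc (x n) ^+ 2)));
  last exact: ell2P.
by apply: nondecreasing_series => i _ _; exact: sqr_ge0.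
Qed.

Lemma coord_sqnorm x n : normc (x n) ^+ 2 <= sqnorm x.
Proof.
apply: le_trans (partial_sqnorm x n.+1).
by rewrite big_nat_recr//= lerDr sumr_ge0// => i _; exact: sqr_ge0.
Qed.

Fact ell2_inner_gt0 x : x != 0 -> 0 < ell2_inner x x.
Proof.
move=> x0; rewrite ell2_innerxx ltcR lt_neqAle; apply/andP; split; last first.
  exact: le_trans (sqr_ge0 _) (coord_sqnorm x 0).
apply: contra x0 => /eqP s0; apply/eqP/val_inj/funext => n.
have := coord_sqnorm x n; rewrite -s0 => le0.
rewrite raddf0; apply: eq0_normc; apply/eqP; rewrite -sqrf_eq0.
by rewrite eq_le le0 sqr_ge0.
Qed.

HB.instance Definition _ :=
  isDotProduct.Build R[i] ell2 ell2_inner ell2_inner_gt0.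

Let ell2_norm x : R[i] := sqrtC (ell2_inner x x).

Fact ell2_normD x y : ell2_norm (x + y) <= ell2_norm x + ell2_norm y.
Proof. exact: dot_normD. Qed.

Fact ell2_normZ (a : R[i]) x : ell2_norm (a *: x) = `|a| * ell2_norm x.
Proof. exact: dot_normZ. Qed.

Fact ell2_norm_eq0 x : ell2_norm x = 0 -> x = 0.
Proof. exact: dot_norm_eq0. Qed.

HB.instance Definition _ :=
  Lmodule_isNormed.Build R[i] ell2 ell2_normD ell2_normZ ell2_norm_eq0.

Fact ell2_inner_normE x : ell2_inner x x = `|x| ^+ 2.
Proof. by rewrite /Num.norm /= sqrtCK. Qed.

End Ell2.

Section Ell2Complete.
Variable R : realType.
Implicit Types x y : ell2 R.

Lemma ell2_norm_sqr x : `|x| ^+ 2 = (sqnorm x)%:C%C.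
Proof. by rewrite -ell2_inner_normE ell2_innerxx. Qed.

Lemma sqnorm_ge0 x : 0 <= sqnorm x.
Proof. exact: le_trans (sqr_ge0 _) (coord_sqnorm x 0). Qed.

Lemma ell2_norm_lt x (e : R) : 0 < e -> (`|x| < e%:C%C) = (sqnorm x < e ^+ 2).
Proof.
move=> e0; rewrite -ltcR rmorphXn /= -ell2_norm_sqr.
by rewrite ltr_pXn2r ?nnegrE ?normr_ge0 ?ler0c ?(ltW e0).
Qed.

Lemma ell2_norm_le x (e : R) : 0 <= e -> (`|x| <= e%:C%C) = (sqnorm x <= e ^+ 2).
Proof.
move=> e0; rewrite -lecR rmorphXn /= -ell2_norm_sqr.
by rewrite ler_pXn2r ?nnegrE ?normr_ge0 ?ler0c.
Qed.

Lemma coord_norm x n : (normc (x n))%:C%C <= `|x|.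
Proof.
rewrite -(@ler_pXn2r _ 2) ?nnegrE ?normr_ge0 ?ler0c ?normc_ge0//.
by rewrite ell2_norm_sqr -rmorphXn /= lecR coord_sqnorm.
Qed.

Lemma cvg_sumR (F : set_system (ell2 R)) (u : nat -> ell2 R -> R) (l : nat -> R)
  N : Filter F -> (forall n, u n @ F --> l n) ->
  (fun x => \sum_(0 <= n < N) u n x) @ F --> \sum_(0 <= n < N) l n.
Proof.
move=> FF ul; elim: N => [|N IHN].
  rewrite big_nil (_ : (fun _ => _) = cst 0); first exact: cvg_cst.
  by apply/funext => x; rewrite big_nil.
rewrite big_nat_recr//= (_ : (fun _ => _) =
  (fun x => \sum_(0 <= n < N) u n x) \+ u N); first exact: cvgD.
by apply/funext => x; rewrite big_nat_recr.
Qed.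

Fact ell2_complete (F : set_system (ell2 R)) :
  ProperFilter F -> cauchy F -> cvg F.
Proof.
move=> FF /cauchy_ballP F_cauchy.
have cpush (g : ell2 R -> R) : (forall x y, (`|g x - g y|)%:C%C <= `|x - y|) ->
    cvg (g @ F).
  move=> gl; apply: cauchy_cvg; apply/cauchy_ballP => e e0.
  have e0C : 0 < (e%:C%C : R[i]) by rewrite ltcR.
  have [[A B] /= [FA FB] AB] := F_cauchy _ e0C.
  exists (g @` A, g @` B) => /=.
    by split; rewrite /nbhs/=; [apply: filterS FA|apply: filterS FB] => x Ax;
      exists x.
  move=> [_ _] /= [[x Ax <-] [y By <-]].
  have := AB (x, y) (conj Ax By); rewrite -!ball_normE /=.
  by move=> xy; rewrite -ltcR (le_lt_trans (gl _ _)).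
pose a n : R[i] := (lim ((fun x => Re (x n)) @ F) +i*
                    lim ((fun x => Im (x n)) @ F))%C.
have aRe n : (fun x => Re (x n)) @ F --> Re (a n).
  apply: cpush => x y; apply: le_trans (coord_norm (x - y) n).
  by rewrite lecR ell2B; apply: le_trans (Re_le_normc _); case: (x n) (y n) => ? ? [].
have aIm n : (fun x => Im (x n)) @ F --> Im (a n).
  apply: cpush => x y; apply: le_trans (coord_norm (x - y) n).
  by rewrite lecR ell2B; apply: le_trans (Im_le_normc _); case: (x n) (y n) => ? ? [].
have key (e : R) : 0 < e -> \forall y \near F, forall N,
    \sum_(0 <= n < N) normc (a n - ell2_val y n) ^+ 2 <= e ^+ 2.
  move=> e0; have e0C : 0 < (e%:C%C : R[i]) by rewrite ltcR.
  have [[A B] /= [FA FB] AB] := F_cauchy _ e0C.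
  apply: filterS FB => y By N.
  pose h x : R := \sum_(0 <= n < N) ((Re (x n) - Re (y n)) ^+ 2 +
                                 (Im (x n) - Im (y n)) ^+ 2).
  have sqB (z w : R[i]) :
      normc (z - w) ^+ 2 = (Re z - Re w) ^+ 2 + (Im z - Im w) ^+ 2.
    by rewrite normc_sqr; case: z w => ? ? [].
  have hF : h @ F --> \sum_(0 <= n < N) normc (a n - ell2_val y n) ^+ 2.
    rewrite /h; under [X in _ --> X]eq_bigr do rewrite sqB.
    apply: (@cvg_sumR _ (fun n x => (Re (x n) - Re (y n)) ^+ 2 +
                                    (Im (x n) - Im (y n)) ^+ 2)) => n.
    by apply: cvgD; rewrite expr2; under eq_fun do rewrite expr2;
      apply: cvgM; apply: cvgB => //; exact: cvg_cst.
  apply: (cvgr_to_le hF).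
  apply: filterS FA => x Ax.
  have := AB (x, y) (conj Ax By); rewrite -!ball_normE /= ell2_norm_lt// => xy.
  apply: le_trans (ltW xy); apply: le_trans (partial_sqnorm (x - y) N).
  by rewrite le_eqVlt; apply/orP; left; apply/eqP; apply: eq_bigr => n _; rewrite ell2B sqB.
have summ y (e : R) : (forall N, \sum_(0 <= n < N) normc (a n - ell2_val y n) ^+ 2 <= e) ->
    cvgn (series (fun n => normc ((a \- ell2_val y) n) ^+ 2)).
  move=> ye; apply: nondecreasing_is_cvgn.
    by apply: nondecreasing_series => i _ _; exact: sqr_ge0.
  by exists e => _ [N _ <-]; exact: ye.
have [y0 y0P] : exists y, forall N, \sum_(0 <= n < N) normc (a n - ell2_val y n) ^+ 2 <= 1 ^+ 2.
  exact: (filter_ex (key 1 ltr01)).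
have aP : a \in @square_summable R.
  have := summ _ _ y0P => /asboolP ay.
  have -> : a = (a - ell2_val y0) + ell2_val y0 by rewrite subrK.
  by rewrite rpredD//; exact: (valP y0).
apply: (@cvgP _ F (Ell2 aP)).
apply/(@cvgrPdist_le _ (ell2 R) _ F FF id) => e e0.
have e0R : 0 < Re e by move: e0; rewrite ltcE => /andP[].
have Ee : e = (Re e)%:C%C by rewrite RRe_real// gtr0_real.
apply: filterS (key _ e0R) => y yP.
rewrite Ee ell2_norm_le ?(ltW e0R)//.
have cy : cvgn (series (fun n => normc ((Ell2 aP - y) n) ^+ 2)) by exact: ell2P.
apply: (cvgr_to_le cy).
apply: nearW => N; apply: le_trans (yP N).
by rewrite le_eqVlt; apply/orP; left; apply/eqP; apply: eq_bigr => n _; rewrite ell2B.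
Qed.

HB.instance Definition _ := Uniform_isComplete.Build (ell2 R) ell2_complete.

HB.instance Definition _ := CompleteNormedModule_isHilbert.Build R (ell2 R)
  (@ell2_inner_normE R).

End Ell2Complete.

Section Invariance.
Variables (R : realType) (H : hilbertType R) (A : set H) (T : bounded_op H).

Lemma closed_span_invariant : (forall x, A x -> lspan A (T x)) ->
  forall x, cs_set (closed_span A) x -> cs_set (closed_span A) (T x).
Proof.
move=> TA.
have TS x : lspan A x -> lspan A (T x).
  move=> [s [sA ->]]; rewrite linear_sum.
  elim: s sA => [_|p s IHs sA]; first by rewrite big_nil; exact: lspan0.
  rewrite big_cons linearZ; apply: lspanP.
    by apply: TA; apply: (sA p); rewrite inE eqxx.
  by apply: IHs => q qs; apply: (sA q); rewrite inE qs orbT.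
move=> x /= Ax B /(@op_continuous _ _ T x) TB.
by have [y [Ay By]] := Ax _ TB; exists (T y); split => //; exact: TS.
Qed.

End Invariance.

Record weights (R : realType) := Weights {
  weight :> nat -> R;
  weight_gt0 : forall n, 0 < weight n;
  weight_bounded : exists C, forall n, weight n <= C
}.

Section WeightedShift.
Variable R : realType.
Implicit Types (l : weights R) (x y : ell2 R).

Definition shift_seq l (x : nat -> R[i]) : nat -> R[i] :=
  fun n => if n is m.+1 then (l m)%:C%C * x m else 0.

Lemma shift_seq_le l x C N : (forall n, l n <= C) ->
  \sum_(0 <= n < N) normc (shift_seq l x n) ^+ 2 <= C ^+ 2 * sqnorm x.
Proof.
move=> lC; have C0 : 0 <= C by apply: le_trans (lC 0); exact/ltW/weight_gt0.
apply: (@le_trans _ _ (C ^+ 2 * \sum_(0 <= n < N) normc (x n) ^+ 2)); last first.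
  by rewrite ler_wpM2l ?sqr_ge0// partial_sqnorm.
case: N => [|N]; first by rewrite !big_nil mulr0.
rewrite big_nat_recl// [X in _ <= _ * X]big_nat_recr//= expr0n /= addr0 sqrtr0.
rewrite expr0n add0r mulrDr; apply: ler_wpDr; first by rewrite mulr_ge0 ?sqr_ge0.
rewrite mulr_sumr; apply: ler_sum => n _.
rewrite normcM exprMn ler_wpM2r ?sqr_ge0//= expr0n /= addr0 sqr_sqrtr ?sqr_ge0//.
by rewrite ler_pXn2r ?nnegrE// ltW// weight_gt0.
Qed.

Fact shift_seq_summable l x : shift_seq l x \in @square_summable R.
Proof.
have [C lC] := weight_bounded l.
apply/asboolP/nondecreasing_is_cvgn.
  by apply: nondecreasing_series => i _ _; exact: sqr_ge0.
by exists (C ^+ 2 * sqnorm x) => _ [N _ <-]; exact: shift_seq_le.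
Qed.

Definition shift_fun l x : ell2 R := Ell2 (shift_seq_summable l x).

Fact shift_fun_linear l : linear (shift_fun l).
Proof.
move=> a x y; apply/val_inj/funext => -[|n].
  by apply/esym; transitivity (a * 0 + 0 : R[i]); rewrite // mulr0 addr0.
transitivity ((l n)%:C%C * (a * x n + y n)) => //.
transitivity (a * ((l n)%:C%C * x n) + (l n)%:C%C * y n) => //.
by rewrite mulrDr mulrCA.
Qed.

HB.instance Definition _ l := GRing.isLinear.Build R[i] (ell2 R) (ell2 R) *:%R
  (shift_fun l) (shift_fun_linear l).

Fact shift_fun_continuous l : continuous (shift_fun l).
Proof.
have [C lC] := weight_bounded l.
have C0 : 0 < C by apply: lt_le_trans (lC 0); exact: weight_gt0.
have C0C : 0 < (C%:C%C : R[i]) by rewrite ltcR.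
have Wle x : `|shift_fun l x| <= C%:C%C * `|x|.
  rewrite -(@ler_pXn2r _ 2) ?nnegrE ?normr_ge0 ?mulr_ge0 ?ler0c ?(ltW C0)//.
  rewrite exprMn !ell2_norm_sqr -rmorphXn -rmorphM /= lecR.
  apply: limr_le; first exact: ell2P.
  by apply: nearW => N; exact: shift_seq_le.
move=> x; apply/(@cvgrPdist_lt _ (ell2 R) _ (nbhs x)) => e e0.
apply/(@nbhs_normP _ (ell2 R)); exists (e / C%:C%C) => /= [|y /= xy].
  by rewrite divr_gt0.
rewrite -raddfB (le_lt_trans (Wle _))//.
by rewrite mulrC -ltr_pdivlMr.
Qed.

Definition wshift l : bounded_op (ell2 R) :=
  @BoundedOp R (ell2 R) (shift_fun l) (@shift_fun_continuous l).

Fact ebasis_summable n : (fun k => (k == n)%:R) \in @square_summable R.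
Proof.
apply/asboolP/nondecreasing_is_cvgn.
  by apply: nondecreasing_series => i _ _; exact: sqr_ge0.
exists 1 => _ [N _ <-]; rewrite /series /=.
have [nN|Nn] := ltnP n N.
  rewrite (bigD1_seq n) ?mem_index_iota ?iota_uniq//= eqxx normc1 expr1n.
  by rewrite big1 ?addr0// => i /negbTE ->; rewrite normc0 expr0n.
rewrite big_nat_cond big1// => i /andP[/andP[_ iN] _].
by rewrite ltn_eqF ?(leq_trans iN)// normc0 expr0n.
Qed.

Definition ebasis n : ell2 R := Ell2 (ebasis_summable n).

Lemma wshift_ebasis l n : wshift l (ebasis n) = (l n)%:C%C *: ebasis n.+1.
Proof.
apply/val_inj/funext => -[|k]; rewrite [RHS]ell2Z /=; first by rewrite mulr0.
rewrite eqSS; case: (eqVneq k n) => [->//|_]; by rewrite !mulr0.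
Qed.

(* The linear span of the basis, and the closed span of the e_j with j >= 1. *)
Definition ell2_fin : set (ell2 R) := lspan (range ebasis).

Definition ell2_tail : csubspace (ell2 R) :=
  closed_span (ebasis @` [set j | (1 <= j)%N]).

Lemma wshift_tail l x : cs_set ell2_tail x -> cs_set ell2_tail (wshift l x).
Proof.
apply: closed_span_invariant => _ [j j1 <-].
rewrite wshift_ebasis -[_ *: _]addr0; apply: lspanP; last exact: lspan0.
by apply: sub_lspan; exists j.+1.
Qed.

Definition wshift_restr l : bounded_op (sub_hilbert ell2_tail) :=
  restriction (@wshift_tail l).

End WeightedShift.

Section Triplet.
Variable R : realType.
Implicit Types (l : weights R) (b c : R)
  (nu : {finite_measure set (measurableTypeR R) -> \bar R}).

Definition hat l (n : nat) : R := \prod_(j < n) l j ^+ 2.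

(* The index bound n.-1 gives j <= n - 2, and an empty sum when n <= 1. *)
Definition Qpoly (n : nat) (x : R) : R :=
  \sum_(j < n.-1) (n - j - 1)%N%:R * x ^+ j.

Definition measure_support nu : set R :=
  [set x | forall U : set R, open U -> U x -> (0 < nu U)%E].

(* A Borel measure on [0, +oo[ is encoded as one on R with nu(]-oo, 0[) = 0. *)
Definition scalar_triplet l b c nu :=
  [/\ 0 <= c,
      nu [set x : R | x < 0] = 0%E,
      compact (measure_support nu),
      nu [set 1 : R] = 0%E
    & forall n : nat,
        ((hat l n)%:E = (1 + b * n%:R + c * n%:R ^+ 2)%:E +
          \int[nu]_(x in [set x : R | (0 <= x)%R]) (Qpoly n x)%:E)%E].

(* A conditionally positive definite weighted shift has exactly one scalar
   representing triplet, so quantifying over the triplets of l amounts to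
   speaking of that triplet. *)
Definition type_I l := forall b c nu, scalar_triplet l b c nu ->
  (forall A : set (measurableTypeR R), measurable A -> nu A = 0%E) /\ c = 0.

Definition type_III l := forall b c nu, scalar_triplet l b c nu ->
  ~ (measure_support nu `<=` [set 0]) \/ c <> 0.

End Triplet.

Section Wab.
Variables (R : realType) (a b : R) (a_gt0 : 0 < a) (b_ge1 : 1 <= b).

Definition Wab_seq (n : nat) : R :=
  if n is m.+1 then
    Num.sqrt ((1 + m.+1%:R * (b - 1)) / (1 + m%:R * (b - 1)))
  else Num.sqrt a.

Let den_gt0 (m : nat) : 0 < 1 + m%:R * (b - 1).
Proof. by rewrite ltr_wpDr// mulr_ge0// subr_ge0. Qed.

Fact Wab_seq_gt0 n : 0 < Wab_seq n.
Proof. by case: n => [|n] /=; rewrite sqrtr_gt0// divr_gt0. Qed.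

Fact Wab_seq_bounded : exists C, forall n, Wab_seq n <= C.
Proof.
exists (Num.sqrt a + Num.sqrt b) => -[|n] /=.
  by rewrite lerDl sqrtr_ge0.
apply: ler_wpDl; first exact: sqrtr_ge0.
apply: ler_wsqrtr; rewrite ler_pdivrMr//.
rewrite -natr1 mulrDl mul1r addrA -[X in _ + X]mul1r -subr_ge0.
have -> : b * (1 + n%:R * (b - 1)) - (1 + n%:R * (b - 1) + 1 * (b - 1)) =
  n%:R * (b - 1) ^+ 2 by ring.
by rewrite mulr_ge0// sqr_ge0.
Qed.

Definition Wab_weights : weights R := Weights Wab_seq_gt0 Wab_seq_bounded.

End Wab.

(* Main.v *)
Require Import Defs.
From HB Require Import structures.
From mathcomp Require Import all_boot all_order all_algebra.
From mathcomp Require Import sesquilinear complex zify ring lra.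
From mathcomp Require Import all_classical all_reals all_analysis.
From mathcomp Require Import measurable_realfun.

Set Implicit Arguments.
Unset Strict Implicit.
Unset Printing Implicit Defensive.

Import Order.TTheory GRing.Theory Num.Theory.
Import numFieldNormedType.Exports.
Import Normc.

Local Open Scope classical_set_scope.
Local Open Scope ring_scope.

(** Write [W] for the weighted shift with weights [l].  The operator [B2 W] is
    diagonal in the standard basis, with entries
    [d n = 1 - 2 * l n ^+ 2 + l n ^+ 2 * l n.+1 ^+ 2] (lemma [B2_wshift]), and
    each condition of the theorem is a statement on this one real sequence.

    - The restriction of [W] to the tail is a 2-isometry iff [d n.+1 = 0] for
      all [n] ([wshift_restr_two_isometryP]).
    - [hat l n * d n] is the second difference of [hat l] at [n].  The second
      difference of [Qpoly] being [x ^+ n], any triplet [(b, c, nu)] satisfies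
      [hat l n * d n = 2 * c + \int x ^+ n dnu] ([triplet_B2_coef]).  When
      [c = 0] and [nu] lives on [{0}] the right-hand side vanishes for [n > 0].
    - [d n.+1 = 0] for all [n] says that [hat l] is affine from index 1 on,
      which is the form of the weights of [W_{a,b}] ([B2_coef_eq0_Wab]); there
      [d 0 = 1 - 2 * a + a * b], and [(a - 1, 0, d 0 * \d_0)] is a triplet
      ([Wab_triplet]).
    - If all [d n] are positive, the seminorm is the norm of [ell2] composed
      with an injective linear map, hence a norm ([B2_seminorm_is_norm]); if
      [d n = 0], it vanishes at the [n]-th basis vector.

    What ties these together is a dichotomy due to conditional positive
    definiteness.  Tested on the [n]-th basis vector, it makes the [2 x 2]
    Hankel matrix of the second differences of the moments of [W] positive
    semidefinite, so [d n >= 0] and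
    [(l n ^+ 2 * d n.+1) ^+ 2 <= d n * (l n ^+ 2 * l n.+1 ^+ 2 * d n.+2)].
    A zero of [d] therefore spreads forward, and backward down to index 1
    ([CPD_B2_coef_eq0]): either [d] has no zero, or [d n.+1 = 0] for all [n].
    In this way the existence of a representing triplet is needed for
    [W_{a,b}] only, where it is explicit. *)

(** * The second-order defect of a weighted shift *)

Section Adjoint.
Variables (R : realType) (H : hilbertType R).

Lemma inner_inj (y z : H) : (forall x, inner x y = inner x z) -> y = z.
Proof.
move=> yz; apply/eqP; rewrite -subr_eq0 -normr_eq0 -sqrf_eq0 -inner_normE.
by rewrite linearBr subr_eq0; apply/eqP; exact: yz.
Qed.

(** The adjoint is chosen among the vectors representing a functional and is a
    default value when there is none; exhibiting one such vector determines
    it, without appeal to the Riesz representation theorem. *)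
Lemma adjoint_unique (T : bounded_op H) y z :
  (forall x, inner (T x) y = inner x z) -> adjoint T y = z.
Proof.
move=> Tyz; rewrite /adjoint; apply: inner_inj => x.
case: xgetP => [w _ wP|/(_ z)]; first by rewrite -wP; exact: Tyz.
by move/(_ Tyz).
Qed.

End Adjoint.

Section WeightedShiftOperator.
Variable R : realType.
Implicit Types (l : weights R) (x y h : ell2 R).

Definition backshift_seq l (y : nat -> R[i]) : nat -> R[i] :=
  fun n => (l n)%:C%C * y n.+1.

Fact backshift_seq_summable l y : backshift_seq l y \in @square_summable R.
Proof.
have [C lC] := weight_bounded l.
have C0 : 0 <= C by apply: le_trans (lC 0); exact/ltW/weight_gt0.
apply/asboolP/nondecreasing_is_cvgn.
  by apply: nondecreasing_series => i _ _; exact: sqr_ge0.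
exists (C ^+ 2 * sqnorm y) => _ [N _ <-]; rewrite /series /=.
apply: (@le_trans _ _ (C ^+ 2 * \sum_(0 <= n < N.+1) normc (y n) ^+ 2)); last first.
  by rewrite ler_wpM2l ?sqr_ge0 ?partial_sqnorm.
rewrite big_nat_recl// mulrDr; apply: ler_wpDl; first by rewrite mulr_ge0 ?sqr_ge0.
rewrite mulr_sumr; apply: ler_sum => n _.
rewrite normcM exprMn ler_wpM2r ?sqr_ge0//= expr0n /= addr0 sqr_sqrtr ?sqr_ge0//.
by rewrite ler_pXn2r ?nnegrE// ltW// weight_gt0.
Qed.

Definition backshift l y : ell2 R := Ell2 (backshift_seq_summable l y).

(** The two series of products differ by one step in the index, the initial
    term on the left being zero. *)
Lemma inner_wshift l x y : inner (wshift l x) y = inner x (backshift l y).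
Proof.
apply: cvg_ell2_inner; rewrite -cvg_shiftS.
have := @ell2_inner_cvg _ x (backshift l y).
rewrite (_ : series _ = fun N =>
  series (fun n => wshift l x n * Num.conj (y n)) N.+1) //.
apply/funext => N; rewrite /series /= big_nat_recl//=.
rewrite [X in _ = X + _]mul0r add0r; apply: eq_bigr => n _.
rewrite /backshift_seq rmorphM /= /shift_seq /=.
rewrite (_ : ((l n)%:C%C)^* = (l n)%:C%C);
  last exact: conjc_real.
by rewrite mulrCA mulrA.
Qed.

Lemma adjoint_wshift l y : adjoint (wshift l) y = backshift l y.
Proof. by apply: adjoint_unique => x; exact: inner_wshift. Qed.

(** The [n]-th diagonal entry of the operator [B2 (wshift l)]. *)
Definition B2_coef l n : R := 1 - 2 * l n ^+ 2 + l n ^+ 2 * l n.+1 ^+ 2.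

Lemma B2_coef_mulr l n (z : R[i]) :
  z - (l n)%:C%C * ((l n)%:C%C * z) *+ 2 +
    (l n)%:C%C * ((l n.+1)%:C%C * ((l n.+1)%:C%C * ((l n)%:C%C * z))) =
  (B2_coef l n)%:C%C * z.
Proof. rewrite /B2_coef; ring. Qed.

Lemma B2_wshift l h n : B2 (wshift l) h n = (B2_coef l n)%:C%C * h n.
Proof.
rewrite /B2 !adjoint_wshift ell2D mulr2n ell2B ell2D -mulr2n -B2_coef_mulr.
by [].
Qed.

(** Coordinates are contractions, so the condition [x 0 = 0] passes to the
    closure; conversely a vector satisfying it is the limit of its
    truncations. *)
Lemma ell2_tailP x : cs_set (ell2_tail R) x <-> x 0 = 0.
Proof.
split=> [Mx|x0].
  apply/eqP; apply: contrapT => /negP x0.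
  have e0 : 0 < (normc (x 0%N))%:C%C :> R[i] by rewrite -normCE normr_gt0.
  have [y [Sy]] := Mx _ (nbhsx_ballx x _ e0).
  have y0 : y 0%N = 0.
    case: Sy => s [sA ->]; elim: s sA => [_|p s IHs sA]; first by rewrite big_nil.
    rewrite big_cons ell2D IHs ?addr0; last first.
      by move=> q qs; apply: sA; rewrite inE qs orbT.
    have [j /= j1 <-] := sA p (mem_head _ _).
    by rewrite [LHS]ell2Z /= (_ : (0%N == j) = false) ?mulr0//; case: j j1.
  rewrite -ball_normE /= => /(le_lt_trans (coord_norm _ 0%N)).
  by rewrite ell2B y0 subr0 ltxx.
move=> B /(@nbhs_normP _ (ell2 R))[e /= e0 eB].
have e0R : 0 < complex.Re e by move: e0; rewrite ltcE => /andP[].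
have Ee : e = (complex.Re e)%:C%C by rewrite RRe_real// gtr0_real.
(* As [x 0 = 0], starting the truncation at 0 keeps it in the span. *)
pose y N := \sum_(0 <= j < N) x j *: ebasis R j.
have yE N n : y N n = if (n < N)%N then x n else 0.
  rewrite /y; elim: N => [|N IHN]; first by rewrite big_nil.
  rewrite big_nat_recr// [LHS]ell2D IHN [X in _ + X = _]ell2Z /= ltnS [in RHS]leq_eqVlt.
  by have [->|nN] := eqVneq n N; rewrite /= ?ltnn ?mulr1 ?add0r// mulr0 addr0.
have Sy N : lspan (@ebasis R @` [set j | (1 <= j)%N]) (y N).
  rewrite /y; elim: N => [|N IHN]; first by rewrite big_nil; exact: lspan0.
  rewrite big_nat_recr//= addrC; case: N IHN => [|N] IHN.
    by rewrite x0 scale0r add0r.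
  by apply: lspanP => //; apply: sub_lspan; exists N.+1.
have xyE N n : (x - y N) n = if (n < N)%N then 0 else x n.
  by rewrite ell2B yE; case: ifP; rewrite ?subrr ?subr0.
have yle N : sqnorm (x - y N) <= sqnorm x - \sum_(0 <= n < N) normc (x n) ^+ 2.
  apply: limr_le; first exact: ell2P.
  near=> M; rewrite lerBrDr; apply: le_trans (partial_sqnorm x M).
  have NM : (N <= M)%N by near: M; exact: nbhs_infty_ge.
  have -> : series (fun n => normc ((x - y N) n) ^+ 2) M =
      \sum_(N <= n < M) normc (x n) ^+ 2.
    transitivity (\sum_(0 <= n < M) normc ((x - y N) n) ^+ 2) => //.
    rewrite (big_cat_nat (leq0n N) NM) [X in X + _ = _]big1_seq; last first.
      move=> n; rewrite mem_index_iota => /andP[_ /andP[_ nN]].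
      by rewrite xyE nN normc0 expr0n.
    by rewrite [LHS]add0r; apply: eq_big_nat => n /andP[Nn _]; rewrite xyE ltnNge Nn.
  by rewrite /series (big_cat_nat (leq0n N) NM) addrC.
have /cvgrPdist_lt/(_ _ (exprn_gt0 2 e0R)) := @ell2P _ x.
case=> N _ /(_ N (leqnn _)) /= xN.
exists (y N); split; first exact: Sy.
apply: eB => /=; rewrite Ee ell2_norm_lt//; apply: le_lt_trans (yle N) _.
exact: le_lt_trans (ler_norm _) xN.
Unshelve. all: by end_near.
Qed.

(** In the tail the adjoint is the backward shift followed by the projection
    that clears coordinate 0. *)
Lemma wshift_restr_adjoint l (y : sub_hilbert (ell2_tail R)) n :
  val (adjoint (wshift_restr l) y) n =
  if n is 0 then 0 else (l n)%:C%C * val y n.+1.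
Proof.
pose z := backshift l (val y) - backshift l (val y) 0%N *: ebasis R 0.
have zE k : z k = if k is 0 then 0 else (l k)%:C%C * val y k.+1.
  by rewrite /z ell2B ell2Z; case: k => [|k] /=; rewrite ?mulr1 ?subrr// mulr0 subr0.
have Mz : cs_set (ell2_tail R) z by exact/ell2_tailP/zE.
rewrite (@adjoint_unique _ _ _ _ (SubHilbert (mem_set Mz))) => [|x]; first exact: zE.
have x0 : val x 0%N = 0 by apply/ell2_tailP/set_mem; exact: valP.
transitivity (inner (wshift l (val x)) (val y)) => //.
rewrite inner_wshift.
apply/esym; apply: cvg_ell2_inner.
have := @ell2_inner_cvg _ (val x) (backshift l (val y)).
rewrite (_ : series _ = series (fun n => val x n * Num.conj (z n))) //.
apply/funext => N; rewrite /series /=; apply: eq_bigr => -[|k] _.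
  by rewrite x0 !mul0r.
by congr (_ * Num.conj _); apply/esym; exact: zE.
Qed.

(** Compressing the adjoint to the tail changes coordinate 0 only, so the
    defect of the restriction has the entries of [B2 (wshift l)] from index 1
    on. *)
Lemma wshift_restr_two_isometryP l :
  two_isometry (wshift_restr l) <-> forall n, B2_coef l n.+1 = 0.
Proof.
have B2E (h : sub_hilbert (ell2_tail R)) n :
    val (B2 (wshift_restr l) h) n.+1 = (B2_coef l n.+1)%:C%C * val h n.+1.
  rewrite /B2 raddfD raddfB raddfMn mulr2n ell2D ell2B ell2D -mulr2n.
  by rewrite !wshift_restr_adjoint -B2_coef_mulr.
split=> [W2 n|d0 h].
  have Me : cs_set (ell2_tail R) (ebasis R n.+1) by apply/ell2_tailP.
  have := B2E (SubHilbert (mem_set Me)) n; rewrite W2 /= eqxx mulr1 => /esym.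
  by move/complexI.
apply/val_inj/val_inj/funext => -[|n].
  by transitivity (0 : R[i]) => //; apply/ell2_tailP/set_mem; exact: valP.
by have := B2E h n; rewrite d0 mul0r.
Qed.

End WeightedShiftOperator.

(** * The seminorm attached to the defect *)

Section Seminorm.
Variable R : realType.
Implicit Types (l : weights R) (x y h : ell2 R).

(** A square root of [B2 (wshift l)] when that operator is positive: a negative
    entry has square root 0 here, so that the map is always defined. *)
Definition sqrtB2_seq l (u : nat -> R[i]) : nat -> R[i] :=
  fun n => (Num.sqrt (B2_coef l n))%:C%C * u n.

Fact sqrtB2_seq_summable l h : sqrtB2_seq l h \in @square_summable R.
Proof.
have [C lC] := weight_bounded l.
have l2C n : l n ^+ 2 <= C ^+ 2.
  rewrite ler_pXn2r ?nnegrE ?(ltW (weight_gt0 l n))//.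
  by apply: le_trans (lC n); exact/ltW/weight_gt0.
pose K := 1 + C ^+ 2 * C ^+ 2.
have K0 : 0 <= K by rewrite addr_ge0// mulr_ge0 ?sqr_ge0.
have dK n : Num.sqrt (B2_coef l n) ^+ 2 <= K.
  have [d0|d0] := leP 0 (B2_coef l n); last by rewrite ltr0_sqrtr// expr0n.
  rewrite sqr_sqrtr// /B2_coef /K lerD//; last first.
    exact: ler_pM (sqr_ge0 _) (sqr_ge0 _) (l2C _) (l2C _).
  by rewrite gerBl mulr_ge0 ?sqr_ge0.
apply/asboolP/nondecreasing_is_cvgn.
  by apply: nondecreasing_series => i _ _; exact: sqr_ge0.
exists (K * sqnorm h) => _ [N _ <-]; rewrite /series /=.
apply: (@le_trans _ _ (K * \sum_(0 <= n < N) normc (h n) ^+ 2)); last first.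
  by rewrite ler_wpM2l ?partial_sqnorm.
rewrite mulr_sumr; apply: ler_sum => n _.
rewrite normcM exprMn ler_wpM2r ?sqr_ge0//= expr0n /= addr0 sqr_sqrtr ?sqr_ge0//.
Qed.

Definition sqrtB2 l h : ell2 R := Ell2 (sqrtB2_seq_summable l h).

Lemma sqrtB2_linear l : linear (sqrtB2 l).
Proof.
move=> a x y; apply/val_inj/funext => n.
set s := (Num.sqrt (B2_coef l n))%:C%C.
transitivity (s * (a * x n + y n)) => //.
transitivity (a * (s * x n) + s * y n) => //.
by rewrite mulrDr mulrCA.
Qed.

(** The seminorm is the pullback of a norm, which yields the norm axioms with
    no further computation. *)
Lemma B2_seminormE l h : (forall n, 0 <= B2_coef l n) ->
  B2_seminorm (wshift l) h = `|sqrtB2 l h|.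
Proof.
move=> d0; rewrite /B2_seminorm; congr sqrtC.
transitivity (ell2_inner (sqrtB2 l h) (sqrtB2 l h)) => //.
apply: cvg_ell2_inner; have := @ell2_inner_cvg _ (sqrtB2 l h) (sqrtB2 l h).
rewrite (_ : series _ = series (fun n => B2 (wshift l) h n * Num.conj (h n))) //.
congr series; apply/funext => n; rewrite B2_wshift.
set s := (Num.sqrt (B2_coef l n))%:C%C.
have sC : s^* = s by exact: conjc_real.
transitivity (s * h n * (s * h n)^*) => //.
by rewrite rmorphM /= sC mulrACA -rmorphM /= -expr2 sqr_sqrtr// mulrA.
Qed.

Lemma B2_seminorm_is_norm l (E : set (ell2 R)) : (forall n, 0 < B2_coef l n) ->
  is_norm_on E (B2_seminorm (wshift l)).
Proof.
move=> d0; have NE h : B2_seminorm (wshift l) h = `|sqrtB2 l h|.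
  by apply: B2_seminormE => n; exact: ltW.
have S0 : sqrtB2 l 0 = 0.
  by apply/val_inj/funext => n; rewrite [LHS]mulr0.
split=> [x _|x y _ _|a x _|x _]; rewrite !NE.
- exact: normr_ge0.
- by have := sqrtB2_linear l 1 x y; rewrite !scale1r => ->; exact: ler_normD.
- by have := sqrtB2_linear l a x 0; rewrite S0 !addr0 => ->; rewrite normrZ.
move=> /eqP; rewrite normr_eq0 => /eqP Sx0.
apply/val_inj/funext => n; apply/eqP.
have : sqrtB2 l x n == 0 by rewrite Sx0.
rewrite [sqrtB2 l x n]/(_ * _) mulf_eq0 => /orP[|//].
by rewrite -[0]/(0%:C%C) (inj_eq (@complexI R)) sqrtr_eq0 leNgt d0.
Qed.

Lemma B2_seminorm_ebasis l n : B2_coef l n = 0 ->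
  B2_seminorm (wshift l) (ebasis R n) = 0.
Proof.
move=> d0; rewrite /B2_seminorm (_ : B2 _ _ = 0) ?linear0l ?sqrtC0//.
apply/val_inj/funext => k; rewrite [LHS]B2_wshift /=.
by have [->|_] := eqVneq k n; rewrite ?d0 ?mul0r ?mulr0.
Qed.

End Seminorm.

(** * Zeros of the defect under conditional positive definiteness *)

Section CPDShift.
Variable R : realType.
Implicit Types (l : weights R).

Lemma norm_ebasis n : `|ebasis R n| = 1.
Proof.
apply/eqP; rewrite -(@eqrXn2 _ 2)// expr1n ell2_norm_sqr; apply/eqP.
rewrite -[RHS]/(1%:C%C); congr (_%:C%C); apply/le_anti/andP; split; last first.
  have := coord_sqnorm (ebasis R n) n.
  by rewrite /= eqxx normc1 expr1n.
apply: limr_le; first exact: ell2P.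
apply: nearW => N; rewrite /series /=.
have [nN|Nn] := ltnP n N.
  rewrite (bigD1_seq n) ?mem_index_iota ?iota_uniq//= eqxx normc1 expr1n.
  by rewrite big1 ?addr0// => i /negbTE ->; rewrite normc0 expr0n.
rewrite big_nat_cond big1// => i /andP[/andP[_ iN] _].
by rewrite ltn_eqF ?(leq_trans iN)// normc0 expr0n.
Qed.

(** The squared norm of the [m]-th iterate of the shift at the [n]-th basis
    vector. *)
Definition moment l n m : R := \prod_(j < m) l (n + j)%N ^+ 2.

Lemma momentS l n m : moment l n m.+1 = moment l n m * l (n + m)%N ^+ 2.
Proof. by rewrite /moment big_ord_recr. Qed.

Lemma norm_iter_wshift l n m :
  `|iter m (wshift l) (ebasis R n)| ^+ 2 = (moment l n m)%:C%C.
Proof.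
have -> : iter m (wshift l) (ebasis R n) =
    (\prod_(j < m) l (n + j)%N)%:C%C *: ebasis R (n + m)%N.
  elim: m => [|m IHm]; first by rewrite big_ord0 addn0 scale1r.
  by rewrite iterS IHm linearZ wshift_ebasis big_ord_recr/= scalerA -rmorphM addnS.
rewrite normrZ norm_ebasis mulr1 normCE -rmorphXn /=; congr (_%:C%C).
by rewrite expr0n /= addr0 sqr_sqrtr ?sqr_ge0// /moment prodrXl.
Qed.

Lemma CPD_moment l n k (alpha : 'I_k.+1 -> R) : CPD (wshift l) ->
  \sum_j alpha j = 0 ->
  0 <= \sum_(i < k.+1) \sum_(j < k.+1) moment l n (i + j)%N * alpha i * alpha j.
Proof.
move=> lC a0; have := lC (ebasis R n) k (fun j => (alpha j)%:C%C).
rewrite -rmorph_sum a0 => /(_ erefl).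
rewrite -ler0c rmorph_sum; congr (0 <= _); apply: eq_bigr => i _.
rewrite rmorph_sum; apply: eq_bigr => j _.
rewrite norm_iter_wshift !rmorphM /=; congr (_ * _).
exact: conjc_real.
Qed.

(** Evaluation at [(- t1, t0)] gives the inequality times [t0]; when [t0 = 0]
    the term linear in [p] has to vanish, as [p = - (t2 + 1)], [q = t1]
    shows. *)
Lemma psd2_discriminant (t0 t1 t2 : R) :
  (forall p q, 0 <= t0 * p ^+ 2 + 2 * t1 * p * q + t2 * q ^+ 2) ->
  t1 ^+ 2 <= t0 * t2.
Proof.
move=> tP; have t0_ge0 : 0 <= t0.
  by have := tP 1 0; rewrite expr1n expr0n/= !mulr0 !addr0 mulr1.
have t2_ge0 : 0 <= t2.
  by have := tP 0 1; rewrite expr1n expr0n/= !mulr0 mul0r !add0r mulr1.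
have := t0_ge0; rewrite le_eqVlt => /orP[/eqP t00|t0_gt0].
  rewrite -t00 mul0r; have := tP (- (t2 + 1)) t1; rewrite -t00 mul0r add0r.
  have -> : 2 * t1 * - (t2 + 1) * t1 + t2 * t1 ^+ 2 = - ((t2 + 2) * t1 ^+ 2).
    by ring.
  by rewrite oppr_ge0 pmulr_rle0// ltr_wpDl.
have := tP (- t1) t0.
have -> : t0 * (- t1) ^+ 2 + 2 * t1 * - t1 * t0 + t2 * t0 ^+ 2 =
  t0 * (t0 * t2 - t1 ^+ 2) by ring.
by rewrite pmulr_rge0// subr_ge0.
Qed.

(** Sequences of sum zero are differences, and summing by parts twice turns a
    form in [moment] into a form in its second differences: the vector
    [(p, q - p, - q)] gives the Hankel form of order two at [(p, q)]. *)
Lemma CPD_B2_coef_psd l n : CPD (wshift l) -> forall p q : R,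
  0 <= B2_coef l n * p ^+ 2 + 2 * (l n ^+ 2 * B2_coef l n.+1) * p * q +
       l n ^+ 2 * l n.+1 ^+ 2 * B2_coef l n.+2 * q ^+ 2.
Proof.
move=> lC p q.
have := @CPD_moment l n 2 (fun j => [:: p; q - p; - q]`_j) lC.
rewrite !big_ord_recl !big_ord0 /bump /= => /(_ _)/le_trans; apply; first by ring.
rewrite !addn0 !momentS !addn0 !addnS addn0 /moment big_ord0 /B2_coef.
by rewrite le_eqVlt; apply/orP; left; apply/eqP; ring.
Qed.

Lemma CPD_B2_coef_ge0 l n : CPD (wshift l) -> 0 <= B2_coef l n.
Proof.
move=> lC; have := CPD_B2_coef_psd n lC 1 0.
by rewrite expr1n expr0n/= !mulr0 !addr0 mulr1.
Qed.

(** By the discriminant inequality an entry of index at least 1 vanishes as soon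
    as one of its two neighbours does.  Index 0 is not reached, having no left
    neighbour. *)
Lemma CPD_B2_coef_eq0 l k : CPD (wshift l) -> B2_coef l k = 0 ->
  forall n, B2_coef l n.+1 = 0.
Proof.
move=> lC; have l0 n : l n != 0 by rewrite gt_eqF ?weight_gt0.
have discr n := psd2_discriminant (CPD_B2_coef_psd n lC).
have eq0 n : (l n ^+ 2 * B2_coef l n.+1) ^+ 2 <= 0 -> B2_coef l n.+1 = 0.
  move=> le0; have : (l n ^+ 2 * B2_coef l n.+1) ^+ 2 == 0.
    by rewrite eq_le le0 sqr_ge0.
  by rewrite sqrf_eq0 mulf_eq0 sqrf_eq0 (negbTE (l0 n)) => /eqP.
have up n : B2_coef l n = 0 -> B2_coef l n.+1 = 0.
  by move=> dn; apply: eq0; apply: le_trans (discr n) _; rewrite dn mul0r.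
have down n : B2_coef l n.+2 = 0 -> B2_coef l n.+1 = 0.
  by move=> dn; apply: eq0; apply: le_trans (discr n) _; rewrite dn !mulr0.
move=> dk; elim => [|n]; last exact: up.
case: k dk => [|k]; first exact: up.
by elim: k => // k IHk /down.
Qed.

End CPDShift.

(** * The shifts with affine moments *)

Section WabCharacterization.
Variable R : realType.
Implicit Types (l : weights R) (a b : R).

Lemma wshift_inj l l' :
  (wshift l = wshift l' :> (ell2 R -> ell2 R)) <-> l =1 l'.
Proof.
split=> [ll' n|ll']; last first.
  apply/funext => x; apply/val_inj/funext => -[|n] //=.
  by rewrite ll'.
have := congr1 (fun T => ell2_val (T (ebasis R n)) n.+1) ll'.
rewrite /= eqxx !mulr1; exact: complexI.
Qed.

(** The hypothesis makes the moments at the basis vector of index 1 an affine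
    sequence [1 + n * (b - 1)]; positivity of all of them forces [1 <= b]. *)
Lemma B2_coef_eq0_Wab l : (forall n, B2_coef l n.+1 = 0) ->
  exists a b (a_gt0 : 0 < a) (b_ge1 : 1 <= b),
    l =1 Wab_weights a_gt0 b_ge1 /\ 1 - 2 * a + a * b = B2_coef l 0.
Proof.
move=> d0; pose b := l 1%N ^+ 2; pose u n := moment l 1 n.
have u_gt0 n : 0 < u n by rewrite prodr_gt0// => j _; rewrite exprn_gt0 ?weight_gt0.
have uE n : u n = 1 + n%:R * (b - 1) /\ u n.+1 = 1 + n.+1%:R * (b - 1).
  elim: n => [|n [un un1]]; split=> //.
  - by rewrite /u /moment big_ord0 mul0r addr0.
  - by rewrite /u momentS /moment big_ord0 addn0 /b; ring.
  have -> : u n.+2 = 2 * u n.+1 - u n + u n * B2_coef l n.+1.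
    by rewrite /u !momentS !add1n /B2_coef; ring.
  by rewrite d0 mulr0 addr0 un un1 -(natr1 n.+1) -(natr1 n); ring.
have b_ge1 : 1 <= b.
  rewrite leNgt; apply/negP => b1.
  have b1' : 0 < 1 - b by rewrite subr_gt0.
  have := u_gt0 (Num.truncn (1 - b)^-1).+1; rewrite (uE _).1.
  have := truncnS_gt (1 - b)^-1; rewrite -(ltr_pM2r b1') mulVf ?gt_eqF//.
  set m := _%:R; lra.
exists (l 0%N ^+ 2), b, (exprn_gt0 2 (weight_gt0 l 0)), b_ge1; split=> // -[|n].
  by rewrite /= sqrtr_sqr gtr0_norm ?weight_gt0.
rewrite /= -(uE n).1 -(uE n).2 /u momentS add1n mulrAC divff ?gt_eqF// mul1r.
by rewrite sqrtr_sqr gtr0_norm ?weight_gt0.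
Qed.

Lemma B2_coef0_Wab a b (a_gt0 : 0 < a) (b_ge1 : 1 <= b) l :
  l =1 Wab_weights a_gt0 b_ge1 -> B2_coef l 0 = 1 - 2 * a + a * b.
Proof.
move=> lE; rewrite /B2_coef !lE /= mul0r addr0 divr1 mul1r (addrC 1 (b - 1)) subrK.
by rewrite !sqr_sqrtr ?(ltW a_gt0)// (le_trans ler01).
Qed.

Lemma hat_Wab a b (a_gt0 : 0 < a) (b_ge1 : 1 <= b) l :
  l =1 Wab_weights a_gt0 b_ge1 -> forall n, hat l n.+1 = a * (1 + n%:R * (b - 1)).
Proof.
move=> lE; have den_gt0 m : 0 < 1 + m%:R * (b - 1).
  by rewrite ltr_wpDr// mulr_ge0// subr_ge0.
elim=> [|n IHn].
  by rewrite /hat big_ord1 lE /= sqr_sqrtr ?(ltW a_gt0)// mul0r addr0 mulr1.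
rewrite /hat big_ord_recr -/(hat l n.+1) IHn /= lE /= sqr_sqrtr; last first.
  by rewrite divr_ge0// ltW.
by rewrite -mulrA (mulrC (1 + _)) divfK ?gt_eqF.
Qed.

End WabCharacterization.

(** * Representing triplets *)

Section Triplet.
Variable R : realType.
Implicit Types (l : weights R) (b c : R)
  (nu : {finite_measure set (measurableTypeR R) -> \bar R}).

Lemma hat_B2_coef l n :
  hat l n.+2 + hat l n = 2 * hat l n.+1 + hat l n * B2_coef l n.
Proof. by rewrite /hat !big_ord_recr /= /B2_coef; ring. Qed.

Lemma hat_gt0 l n : 0 < hat l n.
Proof. by rewrite prodr_gt0// => j _; rewrite exprn_gt0 ?weight_gt0. Qed.

Lemma QpolyS n (x : R) : Qpoly n.+1 x = Qpoly n x + \sum_(j < n) x ^+ j.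
Proof.
rewrite /Qpoly /=; case: n => [|n]; first by rewrite !big_ord0 addr0.
rewrite /= [X in _ + X]big_ord_recr [LHS]big_ord_recr /= addrA -big_split /=.
congr (_ + _); last by rewrite -addn2 addKn mul1r.
apply: eq_bigr => j _; rewrite -[X in _ + X]mul1r -mulrDl natr1; congr (_%:R * _).
by have := ltn_ord j; lia.
Qed.

Lemma Qpoly_diff2 n (x : R) :
  Qpoly n.+2 x + Qpoly n x = 2 * Qpoly n.+1 x + x ^+ n.
Proof. by rewrite !QpolyS big_ord_recr /=; ring. Qed.

Lemma Qpoly_ge0 n (x : R) : 0 <= x -> 0 <= Qpoly n x.
Proof. by move=> x0; apply: sumr_ge0 => j _; rewrite mulr_ge0 ?exprn_ge0. Qed.

Lemma measurable_Qpoly n (D : set (measurableTypeR R)) :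
  measurable_fun D (fun x => (Qpoly n x)%:E).
Proof.
apply/measurable_EFinP; apply: measurable_sum => j.
by apply: measurable_funM => //; exact: exprn_measurable.
Qed.

Lemma measurable_nneg : measurable ([set x : R | 0 <= x] : set (measurableTypeR R)).
Proof.
rewrite (_ : [set x | _] = `[0, +oo[%classic); first exact: measurable_itv.
by apply/seteqP; split=> x /=; rewrite in_itv /= andbT.
Qed.

(** All the integrals involved are of nonnegative functions and finite, being
    determined by [hat l], so the second difference of the defining identity
    can be taken under the integral sign. *)
Lemma triplet_B2_coef l b c nu n : scalar_triplet l b c nu ->
  ((hat l n * B2_coef l n)%:E =
    (2 * c)%:E + \int[nu]_(x in [set x : R | (0 <= x)%R]) (x ^+ n)%:E)%E.
Proof.
move=> [_ _ _ _ lE]; set D := [set x : R | (0 <= x)%R].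
have mD : measurable (D : set (measurableTypeR R)) by exact: measurable_nneg.
pose q m := hat l m - (1 + b * m%:R + c * m%:R ^+ 2).
have QE m : (\int[nu]_(x in D) (Qpoly m x)%:E = (q m)%:E)%E.
  by rewrite EFinB lE addeAC subee ?add0e.
have : (\int[nu]_(x in D) (Qpoly n.+2 x)%:E + \int[nu]_(x in D) (Qpoly n x)%:E =
    2%:E * \int[nu]_(x in D) (Qpoly n.+1 x)%:E + \int[nu]_(x in D) (x ^+ n)%:E)%E.
  rewrite -ge0_integralZl//; last 2 first.
  - exact: measurable_Qpoly.
  - by move=> x Dx; rewrite lee_fin Qpoly_ge0.
  rewrite -!ge0_integralD//; first last.
  - exact: measurable_Qpoly.
  - by move=> x Dx; rewrite lee_fin Qpoly_ge0.
  - exact: measurable_Qpoly.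
  - by move=> x Dx; rewrite lee_fin Qpoly_ge0.
  - by apply/measurable_EFinP; exact: exprn_measurable.
  - by move=> x Dx; rewrite lee_fin exprn_ge0.
  - by apply: measurable_funeM; exact: measurable_Qpoly.
  - by move=> x Dx; rewrite mule_ge0// lee_fin ?Qpoly_ge0.
  by apply: eq_integral => x _; rewrite -EFinM -!EFinD Qpoly_diff2.
rewrite !QE; case: (\int[nu]_(x in D) _)%E => [r| |] //= [] rE.
congr EFin; move: rE; rewrite /q.
have := hat_B2_coef l n; rewrite -!natr1; lra.
Qed.

(** The line has a countable base, so the complement of the support, a union of
    open null sets, is covered by countably many null balls with rational
    center and radius. *)
Lemma negligible_setC_support nu : nu.-negligible (~` measure_support nu).
Proof.
pose B (p : rat * rat) : set R := ball (ratr p.1 : R) (ratr p.2).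
pose F k : set (measurableTypeR R) := if unpickle k is Some p then
  (if nu (B p) == 0%E then B p else set0) else set0.
apply: (@negligibleS _ _ _ _ (\bigcup_k F k)); last first.
  apply: negligible_bigcup => k; rewrite /F.
  case: unpickle => [p|]; last exact: negligible_set0.
  case: ifP => [/eqP nuB|_]; last exact: negligible_set0.
  by apply/negligibleP => //; apply: open_measurable; exact: ball_open.
move=> x /= /existsNP[U /not_implyP[oU /not_implyP[Ux nuU]]].
have nuU0 : nu U = 0%E.
  by apply/eqP; rewrite eq_le measure_ge0 andbT leNgt; apply/negP.
have [p [r [/set_mem xB BU]]] := open_subball_rat oU (mem_set Ux).
exists (pickle (p, r)); [exact: I|rewrite /F pickleK].
suff /eqP -> : nu (B (p, r)) = 0%E by [].
apply: subset_measure0 nuU0 => //.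
- by apply: open_measurable; exact: ball_open.
- exact: open_measurable.
Qed.

Lemma triplet_supp0_B2_coef l b nu : scalar_triplet l b 0 nu ->
  measure_support nu `<=` [set 0] -> forall n, B2_coef l n.+1 = 0.
Proof.
move=> lbn supp0 n; have := triplet_B2_coef n.+1 lbn.
have nu0 : nu (~` [set 0]) = 0%E.
  apply: measure_negligible; first by apply: measurableC; exact: measurable_set1.
  by apply: negligibleS (negligible_setC_support nu); exact: subsetC.
rewrite mulr0 add0e (ge0_negligible_integral _ _ _ _ nu0); first last.
- by move=> x Dx; rewrite lee_fin exprn_ge0.
- by apply/measurable_EFinP; exact: exprn_measurable.
- exact: measurable_nneg.
- by apply: measurableC; exact: measurable_set1.
rewrite integral0_eq => [[] /eqP|x [_ /=]].
  by rewrite mulf_eq0 gt_eqF ?hat_gt0//= => /eqP.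
by move=> /contrapT ->; rewrite expr0n.
Qed.

(** At index 0 the second difference is [2 * c] plus the total mass of [nu], a
    sum of two nonnegative numbers. *)
Lemma triplet_B2_coef0_eq0 l b c nu : scalar_triplet l b c nu ->
  B2_coef l 0 = 0 ->
  (forall A : set (measurableTypeR R), measurable A -> nu A = 0%E) /\ c = 0.
Proof.
move=> lbn d0; have := triplet_B2_coef 0 lbn; case: lbn => c0 nuN _ _ _.
have -> : (\int[nu]_(x in [set x : R | (0 <= x)%R]) (x ^+ 0)%:E =
    nu [set x : R | (0 <= x)%R])%E.
  rewrite -[RHS]mul1e -[RHS]integral_cst//; exact: measurable_nneg.
rewrite d0 mulr0 => /esym/eqP; rewrite padde_eq0 ?lee_fin ?mulr_ge0//.
rewrite eqe mulf_eq0 pnatr_eq0 /= => /andP[/eqP -> /eqP nuP]; split=> // A mA.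
have mN : measurable ([set x : R | x < 0] : set (measurableTypeR R)).
  rewrite (_ : [set x | x < 0] = ~` [set x | 0 <= x]).
    by apply: measurableC; exact: measurable_nneg.
  by apply/seteqP; split=> x /=; rewrite ltNge => /negP.
apply: measure_negligible => //.
apply: (@negligibleS _ _ _ nu
  ([set x : R | 0 <= x] `|` [set x : R | x < 0] : set (measurableTypeR R))).
  by move=> x _ /=; case: (leP 0 x); [left|right].
by apply: negligibleU; apply/negligibleP => //; exact: measurable_nneg.
Qed.

(** [Qpoly n 0] is [n - 1] for [n > 0] and 0 for [n = 0].  A mass
    [w = 1 - 2 * a + a * b] at 0 thus gives the moments
    [1 - w + (a - 1 + w) * n] for [n > 0], and these are
    [a * (1 + (n - 1) * (b - 1))]. *)
Lemma Wab_triplet l a b (a_gt0 : 0 < a) (b_ge1 : 1 <= b) :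
  l =1 Wab_weights a_gt0 b_ge1 -> 0 <= 1 - 2 * a + a * b ->
  exists nu, [/\ scalar_triplet l (a - 1) 0 nu,
    measure_support nu `<=` [set 0] & nu setT = (1 - 2 * a + a * b)%:E].
Proof.
move=> lE w_ge0; pose w := NngNum w_ge0.
pose nu : {finite_measure set (measurableTypeR R) -> \bar R} :=
  mscale w (dirac (0 : measurableTypeR R)).
have nuE A : nu A = ((1 - 2 * a + a * b)%:E * \d_(0%R : R) A)%E by [].
have supp0 : measure_support nu `<=` [set 0].
  move=> x /= nux; apply: contrapT => x0.
  have o0 : open (~` [set 0 : R]) by apply: closed_openC; exact: closed_eq.
  have := nux (~` [set 0]) o0 x0.
  rewrite nuE diracE memNset /= ?mule0 ?ltxx//; exact.
exists nu; split=> //; last by rewrite nuE diracT mule1.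
split=> //.
- by rewrite nuE diracE memNset /= ?mule0 ?ltxx.
- have [->|->] := subset_set1 supp0; first exact: compact0.
  exact: compact_set1.
- rewrite nuE diracE memNset /= ?mule0//.
  by move/eqP; rewrite eq_sym oner_eq0.
move=> n; rewrite ge0_integral_mscale//; first last.
- by move=> x Dx; rewrite lee_fin Qpoly_ge0.
- exact: measurable_Qpoly.
- exact: measurable_nneg.
rewrite integral_dirac; first last.
- exact: measurable_Qpoly.
- exact: measurable_nneg.
rewrite diracE mem_set /= ?lexx// mul1e -EFinM -EFinD; congr EFin.
rewrite mul0r addr0.
have Q0 m : Qpoly m.+1 (0 : R) = m%:R.
  rewrite /Qpoly /=; case: m => [|m]; first by rewrite big_ord0.
  by rewrite big_ord_recl expr0 mulr1 big1 ?addr0// => j _; rewrite expr0n mulr0.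
case: n => [|n]; first by rewrite /hat /Qpoly !big_ord0 !mulr0 !addr0.
by rewrite (hat_Wab lE) Q0 -natr1; ring.
Qed.

End Triplet.

(** * The equivalence *)

Theorem theorem2p4p1 (R : realType) (l : weights R)
    (hCPD : CPD (wshift l)) :
  [<-> ~ two_isometry (wshift_restr l);
       type_III l;
       forall (a b : R) (a_gt0 : 0 < a) (b_ge1 : 1 <= b),
         0 <= 1 - 2 * a + a * b ->
         wshift l <> wshift (Wab_weights a_gt0 b_ge1)
           :> (ell2 R -> ell2 R);
       is_norm_on (@ell2_fin R) (B2_seminorm (wshift l))]
  /\
  forall (a b : R) (a_gt0 : 0 < a) (b_ge1 : 1 <= b),
    0 <= 1 - 2 * a + a * b ->
    wshift l = wshift (Wab_weights a_gt0 b_ge1) :> (ell2 R -> ell2 R) ->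
    (type_I l <-> 1 - 2 * a + a * b = 0).
Proof.
split; last first.
  move=> a b a_gt0 b_ge1 w_ge0 /wshift_inj lE; split=> [lI|w0].
    have [nu [lnu _ nuT]] := Wab_triplet lE w_ge0.
    have [nu0 _] := lI _ _ _ lnu.
    by apply: EFin_inj; rewrite -nuT nu0.
  move=> b' c nu lnu; apply: (triplet_B2_coef0_eq0 lnu).
  by rewrite (B2_coef0_Wab lE).
tfae.
- move=> l_not2 b c nu lnu; apply: contrapT => /not_orP[/contrapT supp0 /contrapT c0].
  apply: l_not2; apply/wshift_restr_two_isometryP.
  by rewrite c0 in lnu; exact: triplet_supp0_B2_coef lnu supp0.
- move=> lIII a b a_gt0 b_ge1 w_ge0 /wshift_inj lE.
  have [nu [lnu supp0 _]] := Wab_triplet lE w_ge0.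
  by have [] := lIII _ _ _ lnu.
- move=> lWab; apply: B2_seminorm_is_norm => n.
  rewrite lt_neqAle CPD_B2_coef_ge0// andbT eq_sym; apply/eqP => dn0.
  have [a [b [a_gt0 [b_ge1 [lE d0E]]]]] :=
    B2_coef_eq0_Wab (CPD_B2_coef_eq0 hCPD dn0).
  apply: (lWab a b a_gt0 b_ge1); last exact/wshift_inj.
  by rewrite d0E CPD_B2_coef_ge0.
move=> [_ _ _ norm_eq0] /wshift_restr_two_isometryP d0.
have e1_fin : @ell2_fin R (ebasis R 1) by apply: sub_lspan; exists 1%N.
have e10 := norm_eq0 _ e1_fin (B2_seminorm_ebasis (d0 0%N)).
have := norm_ebasis R 1; rewrite e10 normr0 => /esym/eqP.
by rewrite oner_eq0.
Qed.
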